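(* If $X$ is a hereditarily unicoherent continuum, then the set $\mathcal M_X=\{M_x:x\in X\}$ of meager composants of $X$ satisfies $|\mathcal M_X|\in\{1,2^{\aleph_0}\}$.
   Context: A continuum is a nonempty compact connected metric space; a subcontinuum of $X$ is a subset of $X$ that is a continuum in the subspace topology (one-point sets are allowed as subcontinua). A continuum $X$ is hereditarily unicoherent if for every two subcontinua $A,B$ of $X$ the intersection $A\cap B$ is connected (the empty set counts as connected). For a continuum $X$ and $x\in X$, the meager composant of $x$ in $X$ is $M_x=\bigcup\{L\subset X: L$ is a nowhere dense subcontinuum of $X$ and $x\in L\}$. *)

(* Defs.v *)
From mathcomp Require Import all_boot classical_sets cardinality topology.

Set Implicit Arguments.
Unset Strict Implicit.
Unset Printing Implicit Defensive.

Local Open Scope classical_set_scope.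

(* [compact] and [connected] are intrinsic to [A] (they agree with compactness
   and connectedness of the subspace [A]), and [connected set0] holds. *)
Definition continuum (T : topologicalType) (A : set T) : Prop :=
  [/\ A !=set0, compact A & connected A].

Definition hereditarily_unicoherent (T : topologicalType) : Prop :=
  forall A B : set T, continuum A -> continuum B -> connected (A `&` B).

Definition nowhere_dense (T : topologicalType) (A : set T) : Prop :=
  (closure A)° = set0.

(* Empty when [T] is a single point, since [T] itself is not nowhere dense. *)
Definition meager_composant (T : topologicalType) (x : T) : set T :=
  \bigcup_(L in [set L : set T | [/\ continuum L, nowhere_dense L & L x]]) L.

(* A set of subsets: points with equal composants contribute one element. *)
Definition meager_composants (T : topologicalType) : set (set T) :=
  range (@meager_composant T).
Arguments meager_composants T : clear implicits.

(* Main.v *)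
(* Let a and b lie in different meager composants. By hereditary unicoherence
   the intersection of all continua through a and b is a continuum; its interior
   W is nonempty, and every continuum through a and b contains W. Hence there is
   no triod of continua each of whose legs has an open part of its own in W.
   Hereditary unicoherence turns this into the following: any two open sets O1,
   O2 in W can be shrunk so that, for some open V, every continuum whose interior
   meets both O1 and O2 contains V. Consequently "lying in the same meager
   composant" is a meager relation on W, and Mycielski's theorem (a Cantor
   scheme) produces continuum many pairwise inequivalent points. *)

From HB Require Import structures.
Require Import Defs.
From mathcomp Require Import all_boot classical_sets cardinality reals topology.
From mathcomp Require Import boolp functions filter.

Set Implicit Arguments.
Unset Strict Implicit.
Unset Printing Implicit Defensive.

Local Open Scope classical_set_scope.
Local Open Scope card_scope.

(** * Compactness and connectedness in compact Hausdorff spaces *)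

Section compact_hausdorff.
Variable T : topologicalType.
Hypotheses (cT : compact [set: T]) (hT : hausdorff_space T).
Implicit Types (A B C G H : set T) (D : set (set T)).

(** Otherwise the parts of the sets [A] outside [G] generate a proper filter, which by compactness
    clusters at a point of the intersection outside [G]. *)
Lemma directed_bigcap_sub D G : D !=set0 ->
    (forall A, D A -> closed A) ->
    (forall A B, D A -> D B -> exists2 C, D C & C `<=` A `&` B) ->
    open G -> \bigcap_(A in D) A `<=` G ->
  exists2 A, D A & A `<=` G.
Proof.
move=> D0 clD DI oG DG; apply: contrapT => noA.
pose F := filter_from D (fun A => A `&` ~` G).
have FF : ProperFilter F.
  apply: filter_from_proper.
    apply: filter_from_filter => // A B DA DB.
    have [C DC CAB] := DI _ _ DA DB; exists C => // x [/CAB[Ax Bx] nGx].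
    by split; split.
  move=> A DA; apply: contrapT => A0; apply: noA; exists A => // x Ax.
  by apply: contrapT => nGx; apply: A0; exists x.
have [p [_ Fp]] := cT FF filterT.
have clp A : D A -> (A `&` ~` G) p.
  move=> DA; have /closure_id -> : closed (A `&` ~` G).
    by apply: closedI; [exact: clD|exact: open_closedC].
  by move=> N Np; apply: Fp => //; exists A.
have [A DA] := D0; have [_] := clp _ DA; apply; apply: DG => B DB.
by have [] := clp _ DB.
Qed.

Lemma normal_disjoint A B : closed A -> closed B -> A `&` B = set0 ->
  exists G H, [/\ open G, open H, A `<=` G, B `<=` H & G `&` H = set0].
Proof.
move=> clA clB AB.
have nT : set_nbhs A (~` B).
  move=> x Ax; apply: open_nbhs_nbhs; split; first exact: closed_openC.
  by move=> Bx; rewrite -[False]/(set0 x) -AB.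
have [C AC CB] := compact_normal hT cT clA nT.
have [G [oG AG GC]] := (set_nbhsP _ _).1 AC.
exists G, (~` closure C); split => //.
- exact/closed_openC/closed_closure.
- by move=> x Bx /CB.
- by rewrite -subset0 => x [/GC Cx]; apply; exact: subset_closure.
Qed.

(** The two halves of a separation of a closed set are closed, so normality encloses them in
    disjoint open sets of the whole space. *)
Lemma closed_connected A : closed A ->
    (forall G H, open G -> open H -> G `&` H = set0 -> A `<=` G `|` H ->
      A `&` G !=set0 -> A `<=` G) ->
  connected A.
Proof.
move=> clA conA; apply/connectedP => E [E0 AE sE].
have AEb b : E b `<=` A by rewrite AE; case: b => x; [right|left].
have clEb b : closure (E b) `<=` E false `|` E true.
  by rewrite -AE; have /closure_id -> := clA; exact/closureS.
have clE b : closed (E b).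
  apply/closure_id; apply/seteqP; split; first exact: subset_closure.
  move=> x cx; have := clEb _ _ cx; case: b cx => cx [] // Ex; exfalso.
  - by rewrite -[False]/(set0 x) -sE.2.
  - by rewrite -[False]/(set0 x) -sE.1.
have [G [H [oG oH EG EH GH]]] :=
  normal_disjoint (clE false) (clE true) (separated_disjoint sE).
have AG : A `<=` G.
  apply: (conA G H) => //; first by rewrite AE => x [/EG|/EH]; [left|right].
  by have [x Ex] := E0 false; exists x; split; [exact: AEb Ex|exact: EG].
have [x Ex] := E0 true; rewrite -[False]/(set0 x) -GH.
by split; [exact/AG/AEb/Ex|exact: EH].
Qed.

End compact_hausdorff.

Lemma connected_sub (T : topologicalType) (A G H : set T) :
    connected A -> open G -> open H -> G `&` H `&` A = set0 ->
    A `<=` G `|` H -> A `&` G !=set0 ->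
  A `<=` G.
Proof.
move=> conA oG oH GH AGH AG; apply/setIidPl; apply: conA => //; first by exists G.
exists (~` H); first exact: open_closedC.
apply/seteqP; split=> x [Ax].
  by move=> Gx; split=> // Hx; rewrite -[False]/(set0 x) -GH.
by move=> nHx; split=> //; have [] := AGH _ Ax.
Qed.

(** * Continua, quasi-components and boundary bumping *)

Section continua.
Variable T : topologicalType.
Hypotheses (cT : compact [set: T]) (hT : hausdorff_space T).
Implicit Types (A B C G H Z Y : set T) (D : set (set T)).

(** By compactness, disjoint open sets covering the intersection already cover one member of [D],
    which is connected. *)
Lemma bigcap_continuum D : D !=set0 -> (\bigcap_(A in D) A) !=set0 ->
    (forall A, D A -> continuum A) ->
    (forall A B, D A -> D B -> D (A `&` B)) ->
  continuum (\bigcap_(A in D) A).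
Proof.
move=> D0 DN cD DI; have clD A : D A -> closed A.
  by move=> /cD[_ cA _]; exact: compact_closed.
have clI : closed (\bigcap_(A in D) A) by exact: closed_bigI.
split=> //; first exact: subclosed_compact clI cT _.
apply: closed_connected => // G H oG oH GH DGH [x [Dx Gx]].
have [A DA AGH] : exists2 A, D A & A `<=` G `|` H.
  apply: directed_bigcap_sub => //; last exact: openU.
  by move=> A B DA DB; exists (A `&` B) => //; exact: DI.
have [_ _ conA] := cD _ DA.
move=> y Dy; apply: (connected_sub conA oG oH) => //; last exact: Dy.
- by rewrite GH set0I.
- by exists x; split=> //; exact: Dx.
Qed.

(* In a compact Hausdorff space quasi-components are connected: the intersection
   of all relatively clopen subsets of [Z] containing [x] is connected, so it
   misses [Y], and by compactness so does one of these sets. *)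
Lemma quasi_component Z Y (x : T) : closed Z -> closed Y -> Z x ->
    (forall C, connected C -> C `<=` Z -> C x -> C `&` Y = set0) ->
  exists A B, [/\ closed A, closed B, A `&` B = set0 & A `|` B = Z] /\
    (A x /\ Z `&` Y `<=` B).
Proof.
move=> clZ clY Zx sepY.
pose D : set (set T) := [set A | exists B,
  [/\ closed A, closed B, A `&` B = set0, A `|` B = Z & A x]].
have D0 : D !=set0.
  by exists Z, set0; split; rewrite ?setI0 ?setU0 //; exact: closed0.
have clD A : D A -> closed A by case=> B [].
have DI A B : D A -> D B -> exists2 C, D C & C `<=` A `&` B.
  move=> [A' [cA cA' AA' AAZ Ax]] [B' [cB cB' BB' BBZ Bx]].
  exists (A `&` B) => //; exists (A' `|` B'); split=> //.
  - exact: closedI.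
  - exact: closedU.
  - rewrite -subset0 => y [[Ay By]] [A'y|B'y].
      by rewrite -AA'.
    by rewrite -BB'.
  - apply/seteqP; split=> [y [[Ay _]|]|y Zy].
    + by rewrite -AAZ; left.
    + by move=> [A'y|B'y]; [rewrite -AAZ|rewrite -BBZ]; right.
    + have : (A `|` A') y by rewrite AAZ.
      have : (B `|` B') y by rewrite BBZ.
      by move=> [] By [] Ay; by [left|right; left|right; right].
have conQ : connected (\bigcap_(A in D) A).
  apply: closed_connected => //; first exact: closed_bigI.
  move=> G H oG oH GH.
  wlog Gx : G H oG oH GH / G x => [hw QGH QG|QGH _].
    have : (G `|` H) x by apply: QGH => A [B []].
    move=> [Gx|Hx]; first exact: (hw G H).
    have QH : \bigcap_(A in D) A `<=` H.
      apply: (hw H G) => //; rewrite 1?setIC 1?setUC //.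
      by exists x; split=> // A [B []].
    have [y [Qy Gy]] := QG.
    by exfalso; rewrite -[False]/(set0 y) -GH; split=> //; exact: QH.
  have [A [B [cA cB AB ABZ Ax]] AGH] :=
    directed_bigcap_sub cT D0 clD DI (openU oG oH) QGH.
  suff DAH : D (A `&` ~` H).
    by move=> y /(_ _ DAH)[/AGH[]].
  exists (B `|` (A `&` ~` G)); split.
  - by apply: closedI => //; exact: open_closedC.
  - by apply: closedU => //; apply: closedI => //; exact: open_closedC.
  - rewrite -subset0 => y [[Ay Hy]] [By|[_ Gy]]; first by rewrite -AB.
    by have [] := AGH _ Ay.
  - apply/seteqP; split=> [y|y].
      rewrite -ABZ => -[[Ay _]|]; first by left.
      by move=> [By|[Ay _]]; [right|left].
    rewrite -ABZ => -[Ay|By]; last by right; left.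
    have [Gy|nGy] := pselect (G y); last by right; right.
    by left; split=> // Hy; rewrite -[False]/(set0 y) -GH.
  - by split=> // Hx; rewrite -[False]/(set0 x) -GH.
have QY : \bigcap_(A in D) A `<=` ~` Y.
  move=> y Qy Yy; rewrite -[False]/(set0 y) -(sepY _ conQ) //.
    move=> z; apply; exists set0.
    by split; rewrite ?setI0 ?setU0 //; exact: closed0.
  by move=> A [B []].
have [A [B [cA cB AB ABZ Ax]] AY] :=
  directed_bigcap_sub cT D0 clD DI (closed_openC clY) QY.
by exists A, B; split=> //; split=> // y; rewrite -ABZ => -[[/AY|]].
Qed.

Lemma continuumU A B : continuum A -> continuum B -> A `&` B !=set0 ->
  continuum (A `|` B).
Proof.
move=> [[x Ax] cA conA] [_ cB conB] AB; split.
- by exists x; left.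
- exact: compactU.
- exact: connectedU.
Qed.

Lemma continuum_closed A : continuum A -> closed A.
Proof. by move=> [_ cA _]; exact: compact_closed. Qed.

Lemma closure_continuum A : A !=set0 -> connected A -> continuum (closure A).
Proof.
move=> [x Ax] conA; split; first by exists x; exact: subset_closure.
  by apply: subclosed_compact cT _ => //; exact: closed_closure.
exact: connected_closure.
Qed.

Lemma continuum1 (x : T) : continuum [set x].
Proof. by split; [exists x|exact: compact_set1|exact: connected1]. Qed.

(** If no connected subset of the complement of [G] through [x] reached the closure of [G],
    [quasi_component] would cut off a piece [A] around [x] that is clopen in the whole space. *)
Lemma boundary_bumping G (x : T) : connected [set: T] -> open G -> G !=set0 ->
    ~ G x ->
  exists L, [/\ continuum L, L x, L `&` G = set0 & L `&` closure G !=set0].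
Proof.
move=> conT oG [g Gg] nGx; apply: contrapT => noL.
have [C conC CG Cx|A [B [[cA cB AB ABG] [Ax GB]]]] :=
  quasi_component (open_closedC oG) (@closed_closure _ G) nGx.
  apply: contrapT => CY; apply: noL; exists (closure C).
  have cCG : closure C `<=` ~` G.
    by have /closure_id -> := open_closedC oG; exact: closureS.
  split.
  - by apply: closure_continuum => //; exists x.
  - exact: subset_closure.
  - by rewrite -subset0 => y [/cCG].
  - have [y Cy] : C `&` closure G !=set0 by exact/set0P/eqP.
    by exists y; split; [exact/subset_closure/Cy.1|exact: Cy.2].
have AT : [set: T] `<=` ~` (B `|` closure G).
  apply: (connected_sub conT (H := ~` A)).
  - by apply: closed_openC; apply: closedU => //; exact: closed_closure.
  - exact: closed_openC.
  - rewrite -subset0 => y [[nBy nAy] _]; apply: nBy.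
    have [Gy|nGy] := pselect (G y); first by right; exact: subset_closure.
    by left; have : (A `|` B) y; [rewrite ABG|case].
  - move=> y _; have [Ay|] := pselect (A y); last by right.
    left=> -[By|Gy]; first by rewrite -[False]/(set0 y) -AB.
    rewrite -[False]/(set0 y) -AB; split=> //; apply: GB; split=> //.
    by rewrite -ABG; left.
  - exists x; split=> // -[Bx|Gx]; first by rewrite -[False]/(set0 x) -AB.
    by rewrite -[False]/(set0 x) -AB; split=> //; apply: GB.
by apply: (AT g) => //; right; exact: subset_closure.
Qed.

End continua.

(** * Three indices, and finite refinement of open families *)

Lemma exists_third (i j : 'I_3) : exists k, k != i /\ k != j.
Proof.
case: i j => [[|[|[|//]]] ?] [[|[|[|//]]] ?];
  by [exists (@Ordinal 3 0 isT)|exists (@Ordinal 3 1 isT)|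
      exists (@Ordinal 3 2 isT)].
Qed.

(** Makes the intersection over all [j != i] a binary one for the legs of a triod. *)
Lemma ord3_cases (i j : 'I_3) : j != i -> j = ordS i \/ j = ord_pred i.
Proof.
by case: i j => [[|[|[|//]]] ?] [[|[|[|//]]] ?] // _;
  by [left; exact: val_inj|right; exact: val_inj].
Qed.

Section refinement.
Variable T : topologicalType.

Definition open_family (I : Type) (s : I -> set T) :=
  forall i, open (s i) /\ s i !=set0.

Definition refines (I : Type) (s' s : I -> set T) := forall i, s' i `<=` s i.

Lemma refines_trans (I : Type) (s1 s2 s3 : I -> set T) :
  refines s1 s2 -> refines s2 s3 -> refines s1 s3.
Proof. by move=> s12 s23 i; exact: subset_trans (s12 i) (s23 i). Qed.

(** The conditions indexed by [l] are met one at a time; being stable under shrinking, those already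
    met survive. *)
Lemma refine_all (I : Type) (J : eqType) (P : J -> (I -> set T) -> Prop)
    (l : seq J) (s0 : I -> set T) :
    (forall j s s', refines s' s -> P j s -> P j s') ->
    (forall j s, j \in l -> open_family s -> refines s s0 ->
      exists s', [/\ open_family s', refines s' s & P j s']) ->
    open_family s0 ->
  exists s, [/\ open_family s, refines s s0 & forall j, j \in l -> P j s].
Proof.
move=> Pmono + os0; elim: l => [_|j l IH Pref]; first by exists s0; split=> // i.
have [k s kl|s [os ss0 Ps]] := IH; first by apply: Pref; rewrite inE kl orbT.
have [|s' [os' s's Ps']] := Pref j s _ os ss0; first by rewrite inE eqxx.
exists s'; split=> //; first exact: refines_trans ss0.
by move=> k; rewrite inE => /predU1P[->//|/Ps]; exact: Pmono.
Qed.

End refinement.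

(** * Triods and separation by open sets *)

Section separation.
Variable T : topologicalType.
Hypotheses (cT : compact [set: T]) (hT : hausdorff_space T).
Hypothesis conT : connected [set: T].
Implicit Types (K L O U V W : set T) (a b x y z : T).

(* Each of [a] and [b] is joined to some leg by a continuum avoiding the open
   parts of the two other legs; going through at most two legs, one gets from
   [a] to [b] while avoiding the open part of a third leg. *)
Lemma no_triod W a b (O P : 'I_3 -> set T) z :
    (forall K, continuum K -> K a -> K b -> W `<=` K) ->
    open_family O -> (forall i, O i `<=` W) ->
    (forall i, continuum (P i)) -> (forall i, P i z) ->
    (forall i, O i `<=` P i) -> (forall i j, j != i -> P i `&` O j = set0) ->
  False.
Proof.
move=> WK oO OW cP Pz OP PO.
have leg x : exists i L, [/\ continuum L, L x, L `&` P i !=set0 &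
    forall j, j != i -> L `&` O j = set0].
  have [[i Oix]|nOx] := pselect (exists i, O i x).
    exists i, (P i); split=> //; first exact: OP.
    - by exists z.
    - by move=> j; exact: PO.
  have [|||L [cL Lx LO [y [Ly Oy]]]] :=
    @boundary_bumping _ cT hT (\bigcup_i O i) x conT.
  - by apply: bigcup_open => i _; exact: (oO i).1.
  - by have [y Oy] := (oO ord0).2; exists y; exists ord0.
  - by move=> [i _ Oix]; apply: nOx; exists i.
  have clP : closed (\bigcup_i P i).
    apply: closed_bigcup => [|i _]; first exact: finite_finset.
    exact: continuum_closed.
  have [i _ Py] : (\bigcup_i P i) y.
    have /closure_id -> := clP; apply: closureS Oy => w [i _ Ow].
    by exists i => //; exact: OP.
  exists i, L; split=> //; first by exists y.
  move=> j _; rewrite -subset0 => w [Lw Ow].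
  by rewrite -LO; split=> //; exists j.
have [[i [La [cLa Laa Lai La0]]] [j [Lb [cLb Lbb Lbj Lb0]]]] := (leg a, leg b).
have [k [ki kj]] := exists_third i j.
have cK : continuum ((La `|` P i) `|` (Lb `|` P j)).
  apply: continuumU; [exact: continuumU|exact: continuumU|].
  by exists z; split; right.
have [y Oy] := (oO k).2.
have : ((La `|` P i) `|` (Lb `|` P j)) y.
  by apply: WK (OW _ _ Oy) => //; [left; left|right; left].
case=> -[Ky|Ky].
- by rewrite -[False]/(set0 y) -(La0 _ ki).
- by rewrite -[False]/(set0 y) -(PO _ _ ki).
- by rewrite -[False]/(set0 y) -(Lb0 _ kj).
- by rewrite -[False]/(set0 y) -(PO _ _ kj).
Qed.

(** Interiors are used so that a counterexample [K] contains smaller open subsets of [O1] and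
    [O2]. *)
Definition separates V O1 O2 := forall K, continuum K ->
  K° `&` O1 !=set0 -> K° `&` O2 !=set0 -> V `<=` K.

Lemma separates_sub V V' O1 O1' O2 O2' : V' `<=` V -> O1' `<=` O1 ->
  O2' `<=` O2 -> separates V O1 O2 -> separates V' O1' O2'.
Proof.
move=> VV' O11 O22 sep K cK [x [Kx Ox]] [y [Ky Oy]].
apply: subset_trans VV' _; apply: sep => //; first by exists x; split=> //; exact: O11.
by exists y; split=> //; exact: O22.
Qed.

(** If it failed, any smaller open sets would admit a continuum whose interior meets two of them and
    which does not contain the third. Doing this for all ordered pairs among three open sets in [O2]
    yields a triod centred in [O1], against [no_triod]. *)
Lemma exists_separates W a b O1 O2 : hereditarily_unicoherent T ->
    (forall K, continuum K -> K a -> K b -> W `<=` K) ->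
    open O1 -> O1 !=set0 -> open O2 -> O2 !=set0 -> O2 `<=` W ->
  exists O1' O2' V, [/\ open O1' /\ O1' !=set0, open O2' /\ O2' !=set0,
    open V /\ V !=set0, O1' `<=` O1 /\ O2' `<=` O2 & separates V O1' O2'].
Proof.
move=> huT WK oO1 O1N oO2 O2N O2W; apply: contrapT => nsep.
have join O1' O2' V : open O1' -> O1' !=set0 -> open O2' -> O2' !=set0 ->
    open V -> V !=set0 -> O1' `<=` O1 -> O2' `<=` O2 ->
    exists K, [/\ continuum K, K° `&` O1' !=set0, K° `&` O2' !=set0 &
      ~ V `<=` K].
  move=> oO1' O1N' oO2' O2N' oV VN O11 O22; apply: contrapT => noK.
  apply: nsep; exists O1', O2', V; split=> // K cK KO1 KO2.
  by apply: contrapT => VK; apply: noK; exists K.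
(* [s None] is the region of the centre and [s (Some i)] the open part of leg [i]; the pair [(i, j)]
   asks for a continuum containing the centre and part [i] and missing part [j]. *)
pose P (p : 'I_3 * 'I_3) (s : option 'I_3 -> set T) := exists K,
  [/\ continuum K, s None `<=` K, s (Some p.1) `<=` K &
      K `&` s (Some p.2) = set0].
pose s0 (o : option 'I_3) := if o is Some _ then O2 else O1.
pose l := [seq p <- enum {: 'I_3 * 'I_3} | p.2 != p.1].
have [||//|s [os ss0 Ps]] := @refine_all _ _ _ P l s0.
- move=> [i j] s s' s's [K [cK sNK siK sjK]]; exists K; split=> //.
  + exact: subset_trans (s's _) sNK.
  + exact: subset_trans (s's _) siK.
  + by rewrite -subset0 -sjK => x [Kx /s's].
- move=> [i j] s; rewrite mem_filter /= => /andP[ji _] os ss0.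
  have [K [cK [x [Kx sx]] [y [Ky sy]] /existsNP[w /not_implyP[sw Kw]]]] :
      exists K, [/\ continuum K, K° `&` s None !=set0,
        K° `&` s (Some i) !=set0 & ~ s (Some j) `<=` K].
    apply: join; first [exact: (os _).1|exact: (os _).2|idtac].
    + exact: (ss0 None).
    + exact: (ss0 (Some i)).
  have oKc : open (~` K) by apply: closed_openC; exact: continuum_closed.
  exists (fun o => s o `&` (if o == Some j then ~` K else
    if o == None :> option 'I_3 then K° else if o == Some i then K° else setT)).
  split.
  + move=> [k|] /=; last first.
      by split; [apply: openI; [exact: (os _).1|exact: open_interior]|exists x].
    have [[->]|_] := eqVneq (Some k) (Some j).
      by split; [apply: openI; [exact: (os _).1|]|exists w].
    have [[->]|_] := eqVneq (Some k) (Some i).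
      by split; [apply: openI; [exact: (os _).1|exact: open_interior]|exists y].
    by rewrite setIT; exact: os.
  + by move=> o u [].
  + exists K; split=> //=.
    * by move=> u [_ /interior_subset].
    * have -> : (Some i == Some j) = false.
        by apply/eqP => -[ij]; rewrite ij eqxx in ji.
      by rewrite eqxx => u [_ /interior_subset].
    * by rewrite eqxx -subset0 => u [Ku [_ nKu]].
- by case.
(* On the diagonal, [set0] is a default value that makes the relation total for [choice]. *)
have Kij (p : 'I_3 * 'I_3) : exists K, p.2 != p.1 -> [/\ continuum K,
    s None `<=` K, s (Some p.1) `<=` K & K `&` s (Some p.2) = set0].
  have [ji|] := boolP (p.2 != p.1); last by exists set0.
  have [K] : P p s by apply: Ps; rewrite mem_filter ji mem_enum.
  by exists K.
have [K' K'P] := choice Kij.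
pose K i j := K' (i, j).
have KP i j : j != i -> [/\ continuum (K i j),
    s None `<=` K i j, s (Some i) `<=` K i j & K i j `&` s (Some j) = set0].
  exact: (K'P (i, j)).
have neS (i : 'I_3) : ordS i != i by case: i => [[|[|[|]]]].
have neP (i : 'I_3) : ord_pred i != i by case: i => [[|[|[|]]]].
have [z sz] := (os None).2.
(* Leg [i] is the intersection of the two continua that avoid the other two open parts; hereditary
   unicoherence keeps it connected. *)
apply: (@no_triod W a b (s \o Some)
  (fun i => K i (ordS i) `&` K i (ord_pred i)) z) => //=.
- by move=> i; exact: os.
- by move=> i; apply: subset_trans O2W; exact: (ss0 (Some i)).
- move=> i; have [c1 n1 _ _] := KP _ _ (neS i).
  have [c2 n2 _ _] := KP _ _ (neP i).
  split; last exact: huT.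
    by exists z; split; [exact: n1|exact: n2].
  by apply: compact_closedI; [case: c1|exact: continuum_closed].
- move=> i; have [_ n1 _ _] := KP _ _ (neS i).
  by have [_ n2 _ _] := KP _ _ (neP i); split; [exact: n1|exact: n2].
- move=> i x sx; have [_ _ n1 _] := KP _ _ (neS i).
  by have [_ _ n2 _] := KP _ _ (neP i); split; [exact: n1|exact: n2].
- move=> i j ji; have [_ _ _ n] := KP _ _ ji.
  rewrite -subset0 -n => x [[K1 K2] sx]; split=> //.
  by have [->|->] := ord3_cases ji.
Qed.

(** If all points of [O1] were joined to all points of [O2] off [U], one component of the complement
    of [U] would contain both sets, hence also [V], which contains [U]. So some [x] and [y] are not
    joined: either one of them is in [U], or they lie in different clopen pieces of the
    complement. *)
Lemma separates_shrink U V O1 O2 : open U -> U !=set0 -> U `<=` V ->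
    open O1 -> O1 !=set0 -> open O2 -> O2 !=set0 -> separates V O1 O2 ->
  exists O1' O2', [/\ open O1' /\ O1' !=set0, open O2' /\ O2' !=set0,
    O1' `<=` O1, O2' `<=` O2 &
    forall K x y, continuum K -> K x -> K y -> O1' x -> O2' y ->
      K `&` U !=set0].
Proof.
move=> oU [u Uu] UV oO1 [x0 O1x0] oO2 [y0 O2y0] sep.
have clU : closed (~` U) by exact: open_closedC.
have [x [y [O1x O2y xy]]] : exists x y, [/\ O1 x, O2 y &
    forall K, continuum K -> K x -> K y -> K `&` U !=set0].
  apply: contrapT => nxy.
  have join x y : O1 x -> O2 y ->
      exists K, [/\ connected K, K `<=` ~` U, K x & K y].
    move=> O1x O2y; apply: contrapT => noK; apply: nxy; exists x, y; split=> //.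
    move=> K [_ _ conK] Kx Ky; apply: contrapT => KU; apply: noK.
    by exists K; split=> // z Kz Uz; apply: KU; exists z.
  pose C := connected_component (~` U) x0.
  have O2C y : O2 y -> C y.
    by move=> O2y; have [K [conK KU Kx Ky]] := join _ _ O1x0 O2y; exists K.
  have O1C x : O1 x -> C x.
    move=> O1x; have [K [conK KU Kx Ky]] := join _ _ O1x O2y0.
    by apply: connected_component_trans (O2C _ O2y0) _; exists K.
  have clC : closed C by exact: component_closed.
  have cC : continuum C.
    split; [by exists x0; exact: O1C|exact: subclosed_compact clC cT _|].
    exact: component_connected.
  have intC O z : open O -> (forall w, O w -> C w) -> O z -> C° `&` O !=set0.
    move=> oO OC Oz; exists z; split=> //.
    by apply: (filterS OC); exact: open_nbhs_nbhs.
  have := sep _ cC (intC _ _ oO1 O1C O1x0) (intC _ _ oO2 O2C O2y0).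
  by move=> /(_ _ (UV _ Uu)) /connected_component_sub.
have [Ux|nUx] := pselect (U x).
  exists (O1 `&` U), O2; split=> //.
  - by split; [exact: openI|exists x].
  - by split=> //; exists y.
  - by move=> K w ? _ Kw _ [_ Uw] _; exists w.
have [Uy|nUy] := pselect (U y).
  exists O1, (O2 `&` U); split=> //.
  - by split=> //; exists x.
  - by split; [exact: openI|exists y].
  - by move=> K ? w _ _ Kw _ [_ Uw]; exists w.
have [|C conC CU Cx|A [B [[cA cB AB ABU] [Ax By]]]] :=
  @quasi_component _ cT hT (~` U) [set y] x clU _ nUx.
- by apply: compact_closed => //; exact: compact_set1.
- rewrite -subset0 => w [+ wy]; rewrite wy => Cy.
  have [|||z [Cz]] := xy (closure C); [|exact: subset_closure..|].
    by apply: closure_continuum => //; exists x.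
  by have := closureS CU Cz; rewrite -(iffLR (closure_id _) clU).
(* A continuum missing [U] lies in [A] or in [B], so avoiding [B] at one end and [A] at the other
   forces it to meet [U]. *)
exists (O1 `&` ~` B), (O2 `&` ~` A); split.
- split; first by apply: openI => //; exact: closed_openC.
  by exists x; split=> // Bx; rewrite -[False]/(set0 x) -AB.
- split; first by apply: openI => //; exact: closed_openC.
  by exists y; split=> // Ay; rewrite -[False]/(set0 y) -AB; split=> //; exact: By.
- by move=> ? [].
- by move=> ? [].
- move=> K p q [_ _ conK] Kp Kq [_ Bp] [_ Aq]; apply: contrapT => KU.
  have KAB w : K w -> (A `|` B) w.
    by move=> Kw; rewrite ABU => Uw; apply: KU; exists w.
  have KB : K `<=` ~` B.
    apply: (connected_sub conK (H := ~` A)).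
    - exact: closed_openC.
    - exact: closed_openC.
    - by rewrite -subset0 => w [[nB nA] /KAB[]].
    - move=> w _; have [Aw|] := pselect (A w); last by right.
      by left=> Bw; rewrite -[False]/(set0 w) -AB.
    - by exists p.
  by have [|] := KAB _ Kq; [|exact: KB].
Qed.

End separation.

(** * Cantor schemes and Mycielski's theorem *)

Section cantor_scheme.
Variable T : topologicalType.
Hypotheses (cT : compact [set: T]) (hT : hausdorff_space T).

Lemma shrink_closure (O : set T) : open O -> O !=set0 ->
  exists O', [/\ open O', O' !=set0 & closure O' `<=` O].
Proof.
move=> oO [x Ox].
have [V Vx VO] : filter_from (nbhs x) closure O.
  apply: (compact_regular hT cT); first exact: filterT.
  exact: open_nbhs_nbhs.
exists V°; split; first exact: open_interior.
  by exists x.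
by apply: subset_trans VO; apply: closureS; exact: interior_subset.
Qed.

(** The latest bit comes first, so [behead] passes to the parent node. *)
Fixpoint initial_seg (a : nat -> bool) n :=
  if n is n'.+1 then a n' :: initial_seg a n' else [::].

Lemma size_initial_seg a n : size (initial_seg a n) = n.
Proof. by elim: n => //= n ->. Qed.

Lemma initial_seg_inj a b n : initial_seg a n = initial_seg b n ->
  forall i, i < n -> a i = b i.
Proof.
elim: n => // n IH [ab /IH abn] i; rewrite ltnS leq_eqVlt.
by move=> /predU1P[->|/abn].
Qed.

(* The density hypothesis says that [D k] contains a dense open subset of
   [W * W]. In the proof, the open set [s n t] is relevant only for [size t = n],
   and words are extended at their head. *)
Lemma mycielski (W : set T) (D : nat -> T -> T -> Prop) :
    open W -> W !=set0 ->
    (forall k O1 O2, open O1 -> O1 !=set0 -> O1 `<=` W ->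
      open O2 -> O2 !=set0 -> O2 `<=` W ->
      exists O1' O2', [/\ open O1' /\ O1' !=set0, open O2' /\ O2' !=set0,
        O1' `<=` O1, O2' `<=` O2 & forall x y, O1' x -> O2' y -> D k x y]) ->
  exists f : (nat -> bool) -> T, forall a b, a <> b -> forall k, D k (f a) (f b).
Proof.
move=> oW WN denseD.
pose good (s : seq bool -> set T) := open_family s /\ refines s (fun=> W).
(* [p.1] is the level under construction and [p.2] the family of the previous level. The premise
   [good p.2] sits under the existential so that [choice] applies to all [p]. *)
have step (p : nat * (seq bool -> set T)) : exists s', good p.2 ->
    [/\ good s', forall t, closure (s' t) `<=` p.2 (behead t) &
      forall t u k, size t = p.1 -> size u = p.1 -> t <> u -> k <= p.1 ->
      forall x y, s' t x -> s' u y -> D k x y].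
  have [[os sW]|] := pselect (good p.2); last by exists p.2.
  case: p os sW => n s /= os sW.
  have [c cP] := choice
    (fun t => shrink_closure (os (behead t)).1 (os (behead t)).2).
  have oc : open_family c by move=> t; have [] := cP t.
  have cW : refines c (fun=> W).
    move=> t; apply: subset_trans (sW (behead t)).
    by apply: subset_trans (@subset_closure _ _) _; have [] := cP t.
  pose words := [seq val t | t <- enum {: n.-tuple bool}].
  have wordsP t : size t = n -> t \in words.
    move=> tn; apply/mapP; have tnP : size t == n by exact/eqP.
    by exists (Tuple tnP); rewrite ?mem_enum.
  pose pairs := [seq (t, u) | t <- words, u <- words].
  (* Only pairs of words of length [n] and indices [k] up to [n] matter: a finite list for
     [refine_all]. *)
  pose l := [seq (tu, k) | tu <- pairs, k <- iota 0 n.+1].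
  pose P (j : (seq bool * seq bool) * nat) (r : seq bool -> set T) :=
    j.1.1 <> j.1.2 -> forall x y, r j.1.1 x -> r j.1.2 y -> D j.2 x y.
  have [||//|r [or rc Pr]] := @refine_all _ _ _ P l c.
  - by move=> j r r' r'r Pr tu x y /r'r rx /r'r ry; exact: Pr.
  - move=> [[t u] k] r _ or rc.
    have [tu|tu] := eqVneq t u; first by exists r; split=> // i.
    have [O1 [O2 [o1 o2 O1r O2r DO]]] := denseD k (r t) (r u) (or _).1 (or _).2
      (subset_trans (rc t) (cW t)) (or _).1 (or _).2 (subset_trans (rc u) (cW u)).
    exists (fun v => if v == t then O1 else if v == u then O2 else r v); split.
    + by move=> v; case: ifP => // _; case: ifP.
    + by move=> v /=; case: eqP => [-> //|_]; case: eqP => [-> //|_ x].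
    + by move=> _ x y /=; rewrite !eqxx eq_sym (negPf tu); exact: DO.
  exists r => _; split.
  - by split=> //; exact: refines_trans cW.
  - by move=> t; apply: subset_trans (closureS (rc t)) _; have [] := cP t.
  - move=> t u k tn un tu kn x y; apply: (Pr ((t, u), k)) => //.
    apply: allpairs_f; last by rewrite mem_iota.
    by apply: allpairs_f; exact: wordsP.
have [F FP] := choice step.
pose s := fix s n := if n is n'.+1 then F (n, s n') else fun=> W.
have gs n : good (s n).
  elim: n => [|n IH] /=; last by have [] := FP (n.+1, s n) IH.
  by split=> // i.
have [f fP] : {f : (nat -> bool) -> T &
    forall a n, s n (initial_seg a n) (f a)}.
  suff: forall a, exists x, forall n, s n (initial_seg a n) x by move=> /choice.
  move=> a; apply: contrapT => nx.
  (* The closure at level [n.+1] lies in the set of level [n], so a common point of these nested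
     closures lies in every set of the branch. *)
  pose C n := closure (s n.+1 (initial_seg a n.+1)).
  have Cs n : C n `<=` s n (initial_seg a n).
    by have [_ + _] := FP (n.+1, s n) (gs n); apply.
  have Cdecr n m : n <= m -> C m `<=` C n.
    move=> /subnK <-; elim: (m - n) => //= i; apply: subset_trans.
    by apply: subset_trans (@subset_closure _ _); exact: Cs.
  have [|||||_ [n _ <-]] := @directed_bigcap_sub _ cT (range C) set0.
  - by exists (C 0); exists 0.
  - by move=> _ [n _ <-]; exact: closed_closure.
  - move=> _ _ [n _ <-] [m _ <-]; exists (C (maxn n m)); first by exists (maxn n m).
    by rewrite subsetI; split; apply: Cdecr; rewrite ?leq_maxl ?leq_maxr.
  - exact: open0.
  - move=> x Cx; apply: nx; exists x => n; apply: Cs.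
    by apply: Cx; exists n.
  have [x sx] := ((gs n.+1).1 (initial_seg a n.+1)).2.
  by move=> /(_ x); apply; exact: subset_closure.
exists f => a b ab k.
have [i abi] : exists i, a i <> b i.
  by apply: contrapT => /forallNP abE; apply: ab; apply: funext => i; exact: contrapT.
(* At level [n.+1] the two words include bit [i], hence differ, and relation [k] has already been
   imposed. *)
pose n := maxn i k.
have [_ _ sD] := FP (n.+1, s n) (gs n).
apply: (sD (initial_seg a n.+1) (initial_seg b n.+1)).
- exact: size_initial_seg.
- exact: size_initial_seg.
- by move=> /initial_seg_inj /(_ i); rewrite ltnS leq_maxl => /(_ isT).
- by rewrite /= leqW // leq_maxr.
- exact: (fP a n.+1).
- exact: (fP b n.+1).
Qed.

End cantor_scheme.

(** * Countable bases of compact metric spaces *)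

Lemma countable_base (R : realType) (X : metricType R) :
  compact [set: X] -> exists U : nat -> set X, (forall n, open (U n)) /\
    forall x O, open O -> O x -> exists2 n, U n x & U n `<=` O.
Proof.
move=> cX; have [[x0]|X0] := pselect ([set: X] !=set0); last first.
  by exists (fun=> set0); split=> [n|x]; [exact: open0|case: X0; exists x].
pose pX : pseudoPMetricType R :=
  HB.pack (X : Type) (isPointed.Build X x0) (PseudoMetric.on X).
have [B /countable_injP[f finj] [oB baseB]] :=
  @compact_second_countable R pX cX.
(* As [f] is injective on [B], this union is the one base set with code [n], or empty if there is
   none. *)
exists (fun n => \bigcup_(b in B `&` f @^-1` [set n]) b); split=> [n|x O oO Ox].
  by apply: bigcup_open => b [Bb _]; exact: oB.
have [b [Bb bx] bO] := baseB x O (open_nbhs_nbhs (conj oO Ox)).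
exists (f b); first by exists b.
move=> y [c [Bc /= fcb] cy]; apply: bO.
by rewrite -(finj _ _ _ _ fcb) ?inE.
Qed.

(** * Meager composants and families of inequivalent points *)

Section composants.
Variable T : topologicalType.
Hypotheses (cT : compact [set: T]) (hT : hausdorff_space T).
Hypothesis conT : connected [set: T].

Lemma nowhere_denseU (A B : set T) : closed A -> nowhere_dense A ->
  nowhere_dense B -> nowhere_dense (A `|` B).
Proof.
rewrite /nowhere_dense => clA ndA ndB.
rewrite closureU -(iffLR (closure_id _) clA) in ndA *.
have OA : (A `|` closure B)° `<=` A.
  move=> x Ox; apply: contrapT => nAx; rewrite -[False]/(set0 x) -ndB.
  have oOA : open ((A `|` closure B)° `&` ~` A).
    by apply: openI; [exact: open_interior|exact: closed_openC].
  apply: (filterS _ (open_nbhs_nbhs (conj oOA (conj Ox nAx)))) => y [].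
  by move=> /interior_subset[].
rewrite -subset0 -ndA => x Ox; rewrite /interior.
apply: filterS OA _; apply: open_nbhs_nbhs; split=> //; exact: open_interior.
Qed.

(** Adding [L] to a nowhere dense continuum through one point gives one through the other. *)
Lemma meager_composant_eq (L : set T) x y : continuum L -> nowhere_dense L ->
  L x -> L y -> meager_composant x = meager_composant y.
Proof.
move=> cL ndL; wlog suff sub : x y / L x -> L y ->
    meager_composant x `<=` meager_composant y.
  by move=> Lx Ly; apply/seteqP; split; exact: sub.
move=> Lx Ly z [K [cK ndK Kx] Kz]; exists (L `|` K); last by right.
split; last by left.
- by apply: continuumU => //; exists x.
- by apply: nowhere_denseU => //; exact: continuum_closed.
Qed.

(** A singleton with nonempty interior would be clopen, hence the whole connected space. *)
Lemma meager_composant_refl (a b x : T) : a <> b -> meager_composant x x.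
Proof.
move=> ab; exists [set x] => //; split=> //; first exact: continuum1.
have clx : closed [set x] by apply: compact_closed => //; exact: compact_set1.
rewrite /nowhere_dense -(iffLR (closure_id _) clx) -subset0.
move=> z /[dup] /interior_subset -> xx.
have ox : open [set x] by rewrite openE => _ ->.
suff Tx : [set: T] `<=` [set x] by apply: ab; rewrite (Tx a) // (Tx b).
apply: (connected_sub conT ox (closed_openC clx)).
- by rewrite setICr set0I.
- by rewrite setUCr.
- by exists x.
Qed.

Lemma separated_open (a b : T) : hereditarily_unicoherent T ->
    meager_composant a <> meager_composant b ->
  exists W, [/\ open W, W !=set0 &
    forall K, continuum K -> K a -> K b -> W `<=` K].
Proof.
move=> huT Mab; pose D : set (set T) := [set K | [/\ continuum K, K a & K b]].
have DT : D [set: T] by split=> //; split=> //; exists a.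
have cI : continuum (\bigcap_(K in D) K).
  apply: bigcap_continuum => //.
  - by exists [set: T].
  - by exists a => K [].
  - by move=> K [].
  - move=> K L [cK Ka Kb] [cL La Lb]; split=> //; split.
    + by exists a.
    + by apply: compact_closedI; [case: cK|exact: continuum_closed].
    + exact: huT.
have nd : ~ nowhere_dense (\bigcap_(K in D) K).
  by move=> nd; apply: Mab; apply: meager_composant_eq cI nd _ _ => K [].
exists (\bigcap_(K in D) K)°; split; first exact: open_interior.
  apply/set0P/eqP => I0; apply: nd; rewrite /nowhere_dense.
  by rewrite -(iffLR (closure_id _) (continuum_closed hT cI)).
by move=> K cK Ka Kb x /interior_subset; apply.
Qed.

Lemma inequivalent_family (a b : T) (U : nat -> set T) :
    hereditarily_unicoherent T -> (forall n, open (U n)) ->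
    (forall x O, open O -> O x -> exists2 n, U n x & U n `<=` O) ->
    meager_composant a <> meager_composant b ->
  exists f : (nat -> bool) -> T, forall u v, u <> v ->
    meager_composant (f u) <> meager_composant (f v).
Proof.
move=> huT oU baseU Mab; have [W [oW WN WK]] := separated_open huT Mab.
(* [E None] and the [E (Some (n, m))] are countably many relations containing
   dense open sets, and together they exclude a nowhere dense [L] through [x] and
   [y]: if [sepat n x y], then [L] misses some [U m] inside [U n]. *)
pose sepat n x y := exists O1 O2,
  [/\ open O1, open O2, O1 x, O2 y & separates (U n) O1 O2].
pose E (j : option (nat * nat)) x y := match j with
  | None => exists2 n, U n !=set0 & sepat n x y
  | Some (n, m) => U m `<=` U n -> U m !=set0 -> sepat n x y ->
      forall K, continuum K -> K x -> K y -> K `&` U m !=set0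
  end.
pose D k x y := if unpickle k is Some j then E j x y else True.
have [k O1 O2 oO1 O1N O1W oO2 O2N O2W|f fP] := @mycielski _ cT hT W D oW WN.
  rewrite /D; case: (unpickle k) => [[[n m]|]|]; last by exists O1, O2; split.
  - have [[UmUn UmN]|nU] := pselect (U m `<=` U n /\ U m !=set0); last first.
      by exists O1, O2; split=> // x y _ _ UmUn UmN; case: nU.
    have [[x [y [O1x O2y [O1' [O2' [oO1' oO2' O1'x O2'y sep]]]]]]|nsep] :=
        pselect (exists x y, [/\ O1 x, O2 y & sepat n x y]); last first.
      exists O1, O2; split=> // x y O1x O2y _ _ sep.
      by case: nsep; exists x, y.
    have [|||||P [Q [oP oQ PO QO PQ]]] := @separates_shrink _ cT hT (U m) (U n)
      (O1 `&` O1') (O2 `&` O2') (oU m) UmN UmUn.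
    + exact: openI.
    + by exists x.
    + exact: openI.
    + by exists y.
    + by apply: separates_sub sep => // z [].
    exists P, Q; split=> //.
    + by move=> z /PO[].
    + by move=> z /QO[].
    + by move=> p q Pp Qq _ _ _ K cK Kp Kq; exact: (PQ K p q).
  - have [P [Q [V [[oP PN] [oQ QN] [oV [v Vv]] [PO QO] sep]]]] :=
      exists_separates cT hT conT huT WK oO1 O1N oO2 O2N O2W.
    have [n Unv UnV] := baseU _ _ oV Vv.
    exists P, Q; split=> // x y Px Qy; exists n; first by exists v.
    by exists P, Q; split=> //; exact: separates_sub sep.
exists f => u v uv Muv.
have fuv j : E j (f u) (f v) by have := fP _ _ uv (pickle j); rewrite /D pickleK.
have [L [cL ndL Lu] Lv] : meager_composant (f u) (f v).
  by rewrite Muv; apply: (@meager_composant_refl a b) => ab; rewrite ab in Mab.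
have [n [w Unw] sepn] := fuv None.
have clL := continuum_closed hT cL.
have [z [Unz Lz]] : U n `&` ~` L !=set0.
  apply: contrapT => UL; have : (closure L)° w; last by rewrite ndL.
  rewrite -(iffLR (closure_id _) clL).
  apply: (filterS _ (open_nbhs_nbhs (conj (oU n) Unw))) => z Unz.
  by apply: contrapT => Lz; apply: UL; exists z.
have [m Umz UmUL] := baseU z _ (openI (oU n) (closed_openC clL)) (conj Unz Lz).
have [||x [Lx /UmUL[]]] // := fuv (Some (n, m)) _ _ sepn L cL Lu Lv.
- by move=> x /UmUL[].
- by exists z.
Qed.

End composants.

(** * Cardinality of the set of meager composants *)

Theorem theorem14 (R : realType) (X : metricType R)
    (X_continuum : continuum [set: X])
    (X_hu : hereditarily_unicoherent X) :
  meager_composants X #= [set: unit] \/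
  meager_composants X #= [set: set nat].
Proof.
have [[x0 _] cX conX] := X_continuum; have hX := @metric_hausdorff R X.
have [U [oU baseU]] := countable_base cX.
have [[a [b Mab]]|Mconst] := pselect (exists a b : X,
    meager_composant a <> meager_composant b); [right|left].
  have [f fP] := inequivalent_family cX hX conX X_hu oU baseU Mab.
  apply/card_eqPle; split.
    (* Upper bound: a point is determined by the set of indices of its basic neighbourhoods. *)
    apply: card_le_trans (card_image_le _ _) _.
    apply/pcard_injP; exists (fun x => [set n | U n x]) => x y _ _ Uxy.
    apply: contrapT => xy.
    have [n Unx Uny] : exists2 n, U n x & U n `<=` ~` [set y].
      apply: baseU => //; apply: closed_openC; apply: compact_closed => //.
      exact: compact_set1.
    have : [set n | U n y] n by rewrite -Uxy.
    by move=> /Uny; apply.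
  (* Lower bound: through characteristic functions, [f] yields an injection of [set nat] into the
     composants. *)
  pose g (s : set nat) := meager_composant (f (fun n => `[< s n >])).
  have ginj : {in [set: set nat] &, injective g}.
    move=> s t _ _ gst; apply: contrapT => st; apply: fP gst => sE; apply: st.
    by apply/seteqP; split=> n /asboolP; [rewrite (congr1 (@^~ n) sE)|
      rewrite -(congr1 (@^~ n) sE)] => /asboolP.
  rewrite -(card_le_eql (inj_card_eq ginj)); apply: subset_card_le.
  by move=> _ [s _ <-]; exists (f (fun n => `[< s n >])).
have -> : meager_composants X = [set meager_composant x0].
  apply/seteqP; split=> [_ [x _ <-]|_ ->]; last by exists x0.
  by apply: contrapT => Mx; apply: Mconst; exists x, x0.
rewrite -[X in _ #= X](_ : [set tt] = setT); last first.
  by apply/seteqP; split=> // -[].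
rewrite -(image_set1 (fun=> tt) (meager_composant x0)) card_eq_sym.
by apply: inj_card_eq => ? ?; rewrite !inE => -> ->.
Qed.
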